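(* (i) For hypercubes, $k_{\min}(Q_t)=t=\mathrm{diam}(Q_t)=\log_2|V(Q_t)|$. (ii) For complete graphs of order $2^t$ (diameter $1$, $t\ge1$), $k_{\min}(K_{2^t})=t$, realized by $K_{2^t}=\mathrm{Cay}(\mathbb{Z}_2^t,\mathbb{Z}_2^t\setminus\{\mathbf{0}\})$. (iii) For even cycles ($d\ge 2$), $k_{\min}(C_{2d})=d=\mathrm{diam}(C_{2d})$, realized by the quotient labeling of the partition of $E(C_{2d})$ into antipodal pairs of edges, for which the number of classes is $t=d$, the rank of the cycle–class parity matrix is $\rho=0$, and the dimension is $k=t-\rho=d$.
   Context: Graphs are finite, simple, connected and undirected; $\mathrm{diam}$ is the diameter in the shortest-path metric. For a generating set $S\subseteq\mathbb{Z}_2^k\setminus\{0\}$, $\mathrm{Cay}(\mathbb{Z}_2^k,S)$ is the graph on $\mathbb{Z}_2^k$ with edges $\{g,g+s\}$, $s\in S$. $k_{\min}(G)$ is the least $k$ such that $G$ embeds isometrically (distance-preservingly) into $\mathrm{Cay}(\mathbb{Z}_2^k,S)$ for some such $S$. $Q_t=\mathrm{Cay}(\mathbb{Z}_2^t,\{e_1,\dots,e_t\})$ is the hypercube. In $C_{2d}$ with vertices $v_0,\dots,v_{2d-1}$ (indices mod $2d$), antipodal pairs of edges are $\{v_av_{a+1},v_{a+d}v_{a+d+1}\}$. For a partition $F_1,\dots,F_t$ of $E(G)$ and a cycle basis $B_1,\dots,B_c$ of $G$ over $\mathbb{F}_2$, the cycle–class parity matrix is $A[i,j]=|F_j\cap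 E(B_i)|\bmod 2$ with rank $\rho$ over $\mathbb{F}_2$; the quotient labeling assigns to class $j$ the image $g_j$ of the $j$-th standard basis vector in $\mathbb{Z}_2^t/\mathrm{rowspan}(A)\cong\mathbb{Z}_2^{t-\rho}$ and labels each vertex $v$ by the sum of the $g_j$ of the edges on a path from a fixed root to $v$, with $S=\{g_j:g_j\ne\mathbf 0\}$. *)

(* Defs.v *)
From HB Require Import structures.
From mathcomp Require Import all_boot all_order all_fingroup all_algebra.
From mathcomp Require Import boolp reals exp.

Set Implicit Arguments.
Unset Strict Implicit.
Unset Printing Implicit Defensive.

Import GRing.Theory.

Definition log2 (R : realType) (x : R) : R := (ln x / ln 2)%R.

Record graph := Graph {
  vertex :> finType;
  adj : rel vertex;
  adj_sym : symmetric adj;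
  adj_irr : irreflexive adj;
  adj_conn : forall x y : vertex, connect adj x y }.

Section Metric.
Variable G : graph.

Definition has_walk (x y : G) : pred nat :=
  fun n => [exists p : n.-tuple G, path (@adj G) x p && (last x p == y)].

Lemma has_walk_ex (x y : G) : exists n, has_walk x y n.
Proof.
have /connectP[p pP ->] := adj_conn x y.
by exists (size p); apply/existsP; exists (in_tuple p); rewrite pP eqxx.
Qed.

Definition dist (x y : G) : nat := ex_minn (has_walk_ex x y).

Definition diam : nat := \max_(x : G) \max_(y : G) dist x y.

Definition edges : {set {set G}} :=
  [set [set p.1; p.2] | p : G * G & adj p.1 p.2].

End Metric.

Definition isometric (G H : graph) (f : G -> H) : Prop :=
  forall x y : G, dist (f x) (f y) = dist x y.

Definition graph_iso (G H : graph) (f : G -> H) : Prop :=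
  bijective f /\ forall x y : G, adj (f x) (f y) = adj x y.

Definition cay_gen k (S : {set 'rV['F_2]_k}) : Prop :=
  (0%R \notin S) /\ <<S>>%g = [set: 'rV['F_2]_k].

Section Cayley.
Variables (k : nat) (S : {set 'rV['F_2]_k}) (hS : cay_gen S).

Definition cay_adj : rel 'rV['F_2]_k := fun g h => [exists s in S, h == (g + s)%R].

Lemma oppv_F2 (v : 'rV['F_2]_k) : (- v = v)%R.
Proof. by apply/rowP=> i; rewrite mxE; case: (v _ i) => -[|[|]] //= ?; apply/val_inj. Qed.

Lemma cay_sym : symmetric cay_adj.
Proof.
suff H x y : cay_adj x y -> cay_adj y x by move=> x y; apply/idP/idP; apply: H.
case/exists_inP=> s sS /eqP->; apply/exists_inP; exists s => //.
by rewrite -{2}(oppv_F2 s) addrK.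
Qed.

Lemma cay_irr : irreflexive cay_adj.
Proof.
move=> x; apply/negbTE/exists_inP=> -[s sS /eqP e]; have [/negP[]] := hS.
by rewrite -(_ : s = 0%R) //; apply: (addrI x); rewrite addr0.
Qed.

Lemma cay_conn x y : connect cay_adj x y.
Proof.
have tr u v w : connect cay_adj u v -> connect cay_adj (w + u)%R (w + v)%R.
  case/connectP=> p; elim: p u => [|z p IH] u /= => [_ ->//|/andP[uz zp] e].
  apply: connect_trans (IH _ zp e); apply: connect1.
  case/exists_inP: uz => s sS /eqP->; apply/exists_inP; exists s => //.
  by rewrite addrA.
pose A := [set v | connect cay_adj 0%R v].
have gA : group_set A.
  apply/group_setP; split=> [|u v]; rewrite !inE ?connect0 // => u0 v0.
  by apply: connect_trans u0 _; rewrite -{1}(addr0 u); apply: tr.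
have: <<S>>%g \subset Group gA.
  rewrite gen_subG; apply/subsetP=> s sS; rewrite inE; apply/connect1.
  by apply/exists_inP; exists s; rewrite ?add0r.
have [_ ->] := hS => /subsetP/(_ (y - x)%R (in_setT _)).
by rewrite inE => /(tr _ _ x); rewrite addr0 addrC subrK.
Qed.

Definition Cay : graph := Graph cay_sym cay_irr cay_conn.

End Cayley.

(* Some Cay(Z_2^k, S) contains an isometric copy of G. *)
Definition embeds (G : graph) (k : nat) : Prop :=
  exists (S : {set 'rV['F_2]_k}) (hS : cay_gen S) (f : G -> Cay hS), isometric f.

(* k_min(G) = k *)
Definition is_kmin (G : graph) (k : nat) : Prop :=
  embeds G k /\ forall k', embeds G k' -> k <= k'.

Definition std_basis t : {set 'rV['F_2]_t} := [set delta_mx 0%R i | i : 'I_t].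

Lemma std_basis_gen t : cay_gen (std_basis t).
Proof.
split.
  apply/imsetP=> -[i _ /rowP/(_ i)/eqP].
  by rewrite !mxE !eqxx.
apply/setP=> v; rewrite in_setT (row_sum_delta v).
pose A := <<std_basis t>>%G.
have addA : forall u w : 'rV['F_2]_t, u \in A -> w \in A -> (u + w)%R \in A.
  by move=> u w; apply: groupM.
have zA : (0%R : 'rV['F_2]_t) \in A by exact: (group1 A).
apply: (big_ind (fun u => u \in A)) => // i _.
case: (v 0%R i) => -[|[|//]] lt_c.
  by rewrite (_ : Ordinal lt_c = 0%R) ?scale0r //; apply/val_inj.
rewrite (_ : Ordinal lt_c = 1%R) ?scale1r; last exact/val_inj.
by apply: mem_gen; apply: imset_f.
Qed.

Definition Q (t : nat) : graph := Cay (std_basis_gen t).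

Definition nonzero t : {set 'rV['F_2]_t} := [set~ 0%R].

Lemma nonzero_gen t : cay_gen (nonzero t).
Proof.
split; first by rewrite !inE eqxx.
apply/setP=> v; rewrite in_setT; have [->|v0] := eqVneq v 0%R.
  exact: (group1 <<nonzero t>>%G).
by apply: mem_gen; rewrite !inE.
Qed.

Section Complete.
Variable n : nat.

Definition K_adj : rel 'I_n := fun i j => i != j.

Lemma K_sym : symmetric K_adj. Proof. by move=> i j; rewrite /K_adj eq_sym. Qed.

Lemma K_irr : irreflexive K_adj. Proof. by move=> i; rewrite /K_adj eqxx. Qed.

Lemma K_conn i j : connect K_adj i j.
Proof. by have [->|ij] := eqVneq i j; [exact: connect0 | exact: connect1]. Qed.

Definition K : graph := Graph K_sym K_irr K_conn.

End Complete.

Section Cycle.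
Variable n : nat.

(* ordS is i |-> i + 1 mod n; the guard i != j only matters for n = 1. *)
Definition C_adj : rel 'I_n :=
  fun i j => (i != j) && ((ordS i == j) || (ordS j == i)).

Lemma C_sym : symmetric C_adj.
Proof. by move=> i j; rewrite /C_adj eq_sym orbC. Qed.

Lemma C_irr : irreflexive C_adj. Proof. by move=> i; rewrite /C_adj eqxx. Qed.

Lemma C_conn i j : connect C_adj i j.
Proof.
have st (u : 'I_n) : connect C_adj u (ordS u).
  have [<-|nu] := eqVneq u (ordS u); first exact: connect0.
  by apply: connect1; rewrite /C_adj nu eqxx.
have up m (u v : 'I_n) : val v = u + m -> connect C_adj u v.
  elim: m v => [|m IH] v.
    by rewrite addn0 => /val_inj->; exact: connect0.
  rewrite addnS => e; have lt : u + m < n by apply: ltnW; rewrite -e ltn_ord.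
  apply: connect_trans (IH (Ordinal lt) erefl) _.
  suff -> : v = ordS (Ordinal lt) by exact: st.
  by apply/val_inj; rewrite /= modn_small -?e ?ltn_ord.
have [le|/ltnW le] := leqP i j; first by apply: (up (j - i)); rewrite subnKC.
rewrite (sym_connect_sym C_sym).
by apply: (up (i - j)); rewrite subnKC.
Qed.

Definition C : graph := Graph C_sym C_irr C_conn.

Definition C_edge (a : 'I_n) : {set C} := [set a; ordS a].

End Cycle.

(* iter d ordS is a |-> a + d mod 2d. *)
Definition antipodal (d : nat) : {set {set {set C (2 * d)}}} :=
  [set [set C_edge a; C_edge (iter d (@ordS _) a)] | a : 'I_(2 * d)].

Section QuotientLabeling.
Variable G : graph.

Definition edge_vector (X : {set {set G}}) : {ffun {set G} -> ('F_2)^o} :=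
  [ffun e => (e \in X)%:R%R].

Definition is_cycle (X : {set {set G}}) : Prop :=
  exists s : seq G, [/\ ucycle (@adj G) s, 2 < size s
                      & X = [set [set x; next s x] | x in s]].

(* A basis, made of cycles, of the span over F_2 of all the cycles of G. *)
Definition cycle_basis c (B : 'I_c -> {set {set G}}) : Prop :=
  let b := [tuple edge_vector (B i) | i < c] in
  [/\ forall i, is_cycle (B i), free b
    & forall X, is_cycle X -> edge_vector X \in <<b>>%VS].

Lemma cycle_basis_exists :
  exists c (B : 'I_c -> {set {set G}}), cycle_basis B.
Proof.
have ext (s : seq {set {set G}}) : exists s' : seq {set {set G}},
    [/\ {subset s' <= s}, free (map edge_vector s')
      & forall X, X \in s -> edge_vector X \in <<map edge_vector s'>>%VS].
  elim: s => [|Y s [s' [sub fr gen]]]; first by exists [::]; split=> //; exact: nil_free.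
  have [Yin|Yout] := boolP (edge_vector Y \in <<map edge_vector s'>>%VS).
    exists s'; split=> // [X /sub Xs|X]; first by rewrite inE Xs orbT.
    by rewrite inE => /predU1P[->//|/gen].
  exists (Y :: s'); split=> [X||X].
  - by rewrite !inE => /predU1P[->|/sub ->]; rewrite ?eqxx ?orbT.
  - by rewrite /= free_cons Yout.
  - rewrite inE /= span_cons => /predU1P[->|/gen Xs].
      exact: (subvP (addvSl _ _)) (memv_line _).
    exact: (subvP (addvSr _ _)) Xs.
have [s [sub fr gen]] := ext [seq X <- enum {: {set {set G}}} | `[< is_cycle X >]].
exists (size s), (fun i => nth set0 s i); rewrite /cycle_basis.
set b := [tuple _ | _ < _]; have -> : b = map edge_vector s :> seq _.
  apply: (@eq_from_nth _ 0%R) => [|i]; first by rewrite size_tuple size_map.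
  rewrite size_tuple => lt; rewrite (nth_map set0) //.
  by rewrite -(tnth_nth _ b (Ordinal lt)) tnth_mktuple.
split=> // [i|X cX]; last by apply: gen; rewrite mem_filter mem_enum andbT; apply/asboolP.
have := sub _ (mem_nth set0 (ltn_ord i)).
by rewrite mem_filter => /andP[/asboolP].
Qed.

(* F_1, ..., F_t lists the members of P without repetition. *)
Definition enumerates t (F : 'I_t -> {set {set G}}) (P : {set {set {set G}}}) :=
  injective F /\ [set F j | j : 'I_t] = P.

Variables (t : nat) (F : 'I_t -> {set {set G}}).

Definition parity_matrix c (B : 'I_c -> {set {set G}}) : 'M['F_2]_(c, t) :=
  \matrix_(i < c, j < t) (#|F j :&: B i|)%:R%R.

(* v |-> v *m M identifies Z_2^t / rowspan(A) with Z_2^(t - rank A): it is onto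
   with kernel rowspan(A). The image of the j-th basis vector is row j M. *)
Definition quotient_map c (A : 'M['F_2]_(c, t))
    (M : 'M['F_2]_(t, t - \rank A)) : Prop :=
  row_full M /\ (kermx M :=: A)%MS.

Lemma quotient_map_exists c (A : 'M['F_2]_(c, t)) :
  exists M : 'M_(t, t - \rank A), quotient_map M.
Proof.
rewrite /quotient_map -mxrank_coker; exists (col_base (cokermx A)); split.
  exact: col_base_full.
apply/eqmxP/andP; split; last first.
  apply/sub_kermxP; apply: (row_free_inj (row_base_free (cokermx A))).
  by rewrite -mulmxA mulmx_base mul0mx mulmx_coker.
by rewrite submxE -[X in (_ *m X)%R]mulmx_base mulmxA mulmx_ker mul0mx.
Qed.

Variables (k : nat) (M : 'M['F_2]_(t, k)).

Definition quotient_gens : {set 'rV['F_2]_k} :=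
  [set row j M | j : 'I_t & row j M != 0%R].

(* When F partitions the edges, the sum has a single term. *)
Definition edge_label (x y : G) : 'rV['F_2]_k :=
  (\sum_(j < t | [set x; y] \in F j) row j M)%R.

Fixpoint path_label (x : G) (p : seq G) : 'rV['F_2]_k :=
  if p is y :: p' then (edge_label x y + path_label y p')%R else 0%R.

Definition quotient_labeling (r : G) (l : G -> 'rV['F_2]_k) : Prop :=
  forall v : G, exists p : seq G,
    [/\ path (@adj G) r p, uniq (r :: p), last r p = v & l v = path_label r p].

Lemma quotient_labeling_exists r : exists l, quotient_labeling r l.
Proof.
pose P v p := [/\ path (@adj G) r p, uniq (r :: p) & last r p = v].
have ex v : exists p, P v p.
  have /connectP[p0 pP ->] := adj_conn r v.
  by have [p pP' up _] := shortenP pP; exists p.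
exists (fun v => path_label r (sval (cid (ex v)))) => v.
by case: cid => p [? ? ?]; exists p.
Qed.

End QuotientLabeling.

(* Main.v *)
(** A generating set S of Z_2^k contains a basis, so Cay(Z_2^k, S) has diameter
    at most k; hence diam G <= k_min(G), and also |V(G)| <= 2^k_min(G). These
    bounds settle hypercubes, complete graphs and even cycles from below.

    In C_2d the j-th antipodal class is an edge cut. Let psi(v) in Z_2^d record
    on which side of each of the d cuts v lies. Crossing an edge of class j
    flips coordinate j only, so every cycle meets every class an even number of
    times (A = 0) and the quotient labeling is psi followed by an injective
    linear map, up to translation. Since psi(v + d) - psi(v) is the all-ones
    vector, antipodal vertices are sent to distance d, and the triangle
    inequality then forces all the other distances to be preserved. *)

Require Import Defs.
From mathcomp Require Import all_boot all_order all_fingroup all_algebra.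
From mathcomp Require Import reals exp.
From mathcomp Require Import zify.

Set Implicit Arguments.
Unset Strict Implicit.
Unset Printing Implicit Defensive.

Import GRing.Theory.

(** * Distances in graphs *)

Section Distance.
Variable G : graph.

Lemma has_walkP (x y : G) n :
  reflect (exists p, [/\ size p = n, path (@adj G) x p & last x p = y])
    (has_walk x y n).
Proof.
apply: (iffP existsP) => [[p /andP[pP /eqP lp]]|[p [sp pP lp]]].
  by exists p; rewrite size_tuple.
have sp' : size p == n by rewrite sp.
by exists (Tuple sp'); rewrite /= pP lp eqxx.
Qed.

Lemma dist_walk (x y : G) : has_walk x y (dist x y).
Proof. by rewrite /dist; case: ex_minnP. Qed.

Lemma dist_le (x y : G) n : has_walk x y n -> dist x y <= n.
Proof. by move=> w; rewrite /dist; case: ex_minnP => m _; apply. Qed.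

Lemma dist_eq0 (x y : G) : (dist x y == 0) = (x == y).
Proof.
apply/eqP/eqP => [d0|->].
  by have := dist_walk x y; rewrite d0 => /has_walkP[[|? ?] [//= _ _]].
by apply/eqP; rewrite -leqn0; apply/dist_le/has_walkP; exists [::].
Qed.

Lemma distxx (x : G) : dist x x = 0.
Proof. by apply/eqP; rewrite dist_eq0. Qed.

Lemma dist_adj (x y : G) : adj x y -> dist x y <= 1.
Proof. by move=> xy; apply/dist_le/has_walkP; exists [:: y]; rewrite /= xy. Qed.

Lemma dist_triangle (y x z : G) : dist x z <= dist x y + dist y z.
Proof.
have [/has_walkP[p [sp pP lp]] /has_walkP[q [sq qP lq]]] :=
  (dist_walk x y, dist_walk y z).
apply/dist_le/has_walkP; exists (p ++ q).
by rewrite size_cat cat_path last_cat sp sq pP lp qP lq.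
Qed.

Lemma dist_sym (x y : G) : dist x y = dist y x.
Proof.
suff le (u v : G) : dist u v <= dist v u by apply/eqP; rewrite eqn_leq !le.
have /has_walkP[p [sp pP lp]] := dist_walk v u.
apply/dist_le/has_walkP; exists (rev (belast v p)); split.
- by rewrite size_rev size_belast.
- by rewrite -lp rev_path; under eq_path => a b do rewrite adj_sym.
- by rewrite -lp; case: p {sp pP lp} => //= z p; rewrite rev_cons last_rcons.
Qed.

Lemma dist_le_diam (x y : G) : dist x y <= diam G.
Proof.
have row_le : dist x y <= \max_(v : G) dist x v by exact: leq_bigmax.
apply: leq_trans row_le _.
exact: (@leq_bigmax _ (fun u : G => \max_(v : G) dist u v)).
Qed.

Lemma diam_leP n : reflect (forall x y : G, dist x y <= n) (diam G <= n).
Proof.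
apply: (iffP idP) => [le x y|le]; first exact: leq_trans (dist_le_diam x y) le.
by apply/bigmax_leqP => x _; apply/bigmax_leqP => y _.
Qed.

Lemma dist_complete (x y : G) :
  (forall u v : G, adj u v = (u != v)) -> dist x y = (x != y).
Proof.
move=> adjE; apply/eqP; have [->|xy] := eqVneq x y; first by rewrite distxx.
by rewrite eqn_leq dist_adj ?adjE // lt0n dist_eq0.
Qed.

End Distance.

Lemma dist_homo (G H : graph) (f : G -> H) (x y : G) :
  {homo f : u v / adj u v} -> dist (f x) (f y) <= dist x y.
Proof.
move=> fh; have /has_walkP[p [sp pP lp]] := dist_walk x y.
apply/dist_le/has_walkP; exists (map f p).
by rewrite size_map last_map lp (homo_path fh pP).
Qed.

Lemma isometric_inj (G H : graph) (f : G -> H) : isometric f -> injective f.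
Proof.
by move=> iso x y fxy; apply/eqP; rewrite -dist_eq0 -iso fxy dist_eq0.
Qed.

(** * Cayley graphs of Z_2^k *)

Lemma F2_neq0 (a : 'F_2) : a != 0%R -> a = 1%R.
Proof. by case: a => -[|[|]] //= ? _; apply/val_inj. Qed.

Lemma F2_scale k (a : 'F_2) (v : 'rV['F_2]_k) :
  (a *: v)%R = (if a != 0 then v else 0)%R.
Proof. by have [->|/F2_neq0->] := eqVneq a 0%R; rewrite ?scale0r ?scale1r. Qed.

Lemma F2_mulmx_row m k (u : 'rV['F_2]_m) (M : 'M_(m, k)) :
  (u *m M = \sum_(i | u 0 i != 0) row i M)%R.
Proof.
by rewrite mulmx_sum_row [RHS]big_mkcond; apply: eq_bigr => i _;
  rewrite F2_scale.
Qed.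

Lemma gen_rV_sum k (S : {set 'rV['F_2]_k}) (I : finType) (P : pred I)
    (g : I -> 'rV['F_2]_k) :
  (forall i, P i -> g i \in S) -> (\sum_(i | P i) g i)%R \in <<S>>%g.
Proof.
move=> gS; apply: (big_ind (fun u => u \in <<S>>%g)) => [|u w|i Pi].
- exact: (group1 <<S>>%G).
- exact: (groupM (G := <<S>>%G)).
- exact/mem_gen/gS.
Qed.

(** The Hamming weight. Being subadditive, it bounds Cayley distances from below in
    [weight_le_dist]. *)
Definition weight k (u : 'rV['F_2]_k) := #|[set i | u 0%R i != 0%R]|.

Lemma weightD k (u v : 'rV['F_2]_k) : weight (u + v)%R <= weight u + weight v.
Proof.
apply: leq_trans (leq_card_setU _ _); apply/subset_leq_card/subsetP => i.
rewrite !inE !mxE; have [->|//] := eqVneq (u 0%R i) 0%R.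
by rewrite add0r.
Qed.

Lemma weight0 k : weight (0%R : 'rV['F_2]_k) = 0.
Proof. by apply: eq_card0 => i; rewrite !inE mxE eqxx. Qed.

Lemma weight_delta k (i : 'I_k) : weight (delta_mx 0%R i : 'rV['F_2]_k) = 1.
Proof.
by rewrite -[RHS](cards1 i); apply: eq_card => j;
  rewrite !inE mxE eqxx; case: (j == i).
Qed.

Lemma weight_const1 k : weight (const_mx 1%R : 'rV['F_2]_k) = k.
Proof.
by rewrite -[RHS]card_ord; apply: eq_card => i; rewrite !inE mxE oner_eq0.
Qed.

Section CayleyDistance.
Variables (k : nat) (S : {set 'rV['F_2]_k}) (hS : cay_gen S).

Lemma cay_adjD (x y : Cay hS) : adj x y = ((y - x)%R \in S).
Proof.
apply/exists_inP/idP => [[s sS /eqP->]|yxS].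
  by rewrite addrAC subrr add0r.
by exists (y - x)%R => //; rewrite addrC subrK.
Qed.

(** Adding the vectors [g i] one at a time traces a walk with one edge per index. *)
Lemma dist_cay_sum (x : Cay hS) (I : finType) (A : {pred I})
    (g : I -> 'rV['F_2]_k) :
  (forall i, g i \in S) ->
  dist x (x + \sum_(i in A) g i : Cay hS)%R <= #|A|.
Proof.
move=> gS; rewrite -big_enum cardE; elim: (enum A) x => [|i r IH] x /=.
  by rewrite big_nil addr0 distxx.
rewrite big_cons addrA.
apply: leq_trans (dist_triangle (x + g i : Cay hS)%R _ _) _.
by apply: (leq_add (n1 := 1)) (IH _);
  rewrite dist_adj // cay_adjD addrAC subrr add0r.
Qed.

Lemma diam_cay : diam (Cay hS) <= k.
Proof.
apply/diam_leP => x y.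
(* The rows of [A] are the generators. Its row space is a subgroup containing [S], hence everything,
   so [A] has rank [k]. *)
pose A : 'M_(#|S|, k) := (\matrix_(i < #|S|) enum_val i)%R.
have gA : group_set [set v : 'rV_k | (v <= A)%MS].
  apply/group_setP; split=> [|u v]; rewrite !inE ?sub0mx //.
  exact: addmx_sub.
have fullA : row_full A.
  rewrite -sub1mx; apply/row_subP => i.
  have: <<S>>%g \subset Group gA.
    rewrite gen_subG; apply/subsetP=> s sS; rewrite inE.
    rewrite -(enum_rankK_in sS sS).
    by rewrite -(rowK (fun i : 'I_#|S| => enum_val i)) row_sub.
  have [_ ->] := hS => /subsetP/(_ (row i 1%:M)%R (in_setT _)).
  by rewrite inE.
(* [B] keeps [k] rows of [A] that form a basis and [N] inverts it; the nonzero coordinates of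
   [y - x] in this basis tell which generators to add, at most [k] of them. *)
have /row_fullP[N NB] := fullrowsub_full fullA.
set B := rowsub _ _ in NB.
have -> : y = (x + \sum_(i in [pred i | ((y - x) *m N)%R 0 i != 0]) row i B)%R.
  by rewrite -F2_mulmx_row -mulmxA NB mulmx1 addrC subrK.
apply: leq_trans (dist_cay_sum _ _ _) _ => [i|].
  by rewrite row_rowsub rowK enum_valP.
by rewrite -[leqRHS]card_ord max_card.
Qed.

(** A step of a walk adds a generator, which changes the weight of the image under [N] by at most 1.
    Hypercubes use the identity for [N], even cycles an inverse of the quotient map. *)
Lemma weight_le_dist m (N : 'M['F_2]_(k, m)) (x y : Cay hS) :
  (forall s, s \in S -> weight (s *m N)%R <= 1) ->
  weight ((y - x) *m N)%R <= dist x y.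
Proof.
move=> wS; have /has_walkP[p [<- pP <-]] := dist_walk x y.
elim: p x pP => [|z p IH] x /=; first by rewrite subrr mul0mx weight0.
rewrite -[cay_adj _ _ _]/(@adj (Cay hS) x z) cay_adjD => /andP[/wS w1 /IH{}IH].
rewrite [(_ - x)%R](_ : _ = (last z p - z) + (z - x))%R; last first.
  by rewrite addrA subrK.
rewrite mulmxDl; apply: leq_trans (weightD _ _) _.
by rewrite [leqLHS]addnC; apply: (leq_add (n1 := 1)).
Qed.

End CayleyDistance.

Lemma embeds_diam (G : graph) k : embeds G k -> diam G <= k.
Proof.
case=> S [hS [f iso]]; apply/diam_leP => x y; rewrite -iso.
exact: leq_trans (dist_le_diam _ _) (diam_cay hS).
Qed.

Lemma card_rV_F2 k : #|{: 'rV['F_2]_k}| = 2 ^ k.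
Proof. by rewrite card_mx card_Fp // mul1n. Qed.

Lemma embeds_card (G : graph) k : embeds G k -> #|G| <= 2 ^ k.
Proof.
by case=> S [hS [f /isometric_inj/leq_card]]; rewrite card_rV_F2.
Qed.

(** * Hypercubes and complete graphs *)

Lemma diam_Q t : diam (Q t) = t.
Proof.
apply/eqP; rewrite eqn_leq diam_cay /=.
(* The zero and all-ones vectors are [t] apart, since each generator has weight 1. *)
apply: leq_trans (dist_le_diam (0%R : Q t) (const_mx 1%R)).
rewrite -[leqLHS](weight_const1 t) -[const_mx _ in leqLHS]subr0.
rewrite -[(_ - 0)%R]mulmx1; apply: weight_le_dist => s /imsetP[i _ ->].
by rewrite mulmx1 weight_delta.
Qed.

Lemma kmin_Q t : is_kmin (Q t) t.
Proof.
split=> [|k /embeds_diam]; last by rewrite diam_Q.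
by exists (std_basis t), (std_basis_gen t), id.
Qed.

Lemma adj_Cay_nonzero t (u v : Cay (nonzero_gen t)) : adj u v = (u != v).
Proof. by rewrite cay_adjD !inE subr_eq0 eq_sym. Qed.

(** Both graphs are complete on 2^t vertices, so any bijection works; this one enumerates the
    vectors. *)
Lemma K_iso_Cay t :
  exists f : K (2 ^ t) -> Cay (nonzero_gen t), graph_iso f /\ isometric f.
Proof.
pose f (i : K (2 ^ t)) : Cay (nonzero_gen t) :=
  enum_val (cast_ord (esym (card_rV_F2 t)) i).
have bf : bijective f.
  apply: (bij_comp (enum_val_bij _)).
  by exists (cast_ord (card_rV_F2 t)) => i; rewrite ?cast_ordKV ?cast_ordK.
exists f; split; first split=> // x y.
  by rewrite adj_Cay_nonzero (inj_eq (bij_inj bf)).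
move=> x y; rewrite (dist_complete _ _ (@adj_Cay_nonzero t)).
rewrite (inj_eq (bij_inj bf)).
by rewrite dist_complete.
Qed.

Lemma kmin_K t : is_kmin (K (2 ^ t)) t.
Proof.
split=> [|k /embeds_card]; last by rewrite card_ord leq_exp2l.
by have [f [_ iso]] := K_iso_Cay t; exists (nonzero t), (nonzero_gen t), f.
Qed.

Lemma diam_K n : 1 < n -> diam (K n) = 1.
Proof.
move=> n1; apply/eqP; rewrite eqn_leq; apply/andP; split.
  by apply/diam_leP => x y; rewrite dist_complete // leq_b1.
pose x : K n := Ordinal (ltnW n1); pose y : K n := Ordinal n1.
by apply: leq_trans (dist_le_diam x y); rewrite dist_complete.
Qed.

Lemma log2_exp (R : realType) t : log2 ((2 ^ t)%:R : R)%R = t%:R%R.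
Proof.
have ln2 : (ln (2 : R) != 0)%R.
  by rewrite Num.Theory.lt0r_neq0 // ln_gt0 // Num.Theory.ltr1n.
by rewrite /log2 natrX lnXn // -[(ln _ *+ t)%R]mulr_natl mulfK.
Qed.

(** * Even cycles *)

Lemma val_ordS n (a : 'I_n) : val (ordS a) = if a.+1 == n then 0 else a.+1.
Proof.
case: eqP => [an|an] /=; first by rewrite an modnn.
by rewrite modn_small // ltn_neqAle ltn_ord andbT; apply/eqP.
Qed.

Lemma val_iter_ordS n m (a : 'I_n) : val (iter m (@ordS _) a) = (a + m) %% n.
Proof.
elim: m => [|m IH]; first by rewrite addn0 modn_small.
by rewrite [LHS]/= IH addnS -addn1 modnDml addn1.
Qed.

Lemma val_antipode d (a : 'I_(2 * d)) :
  val (iter d (@ordS _) a) = if a < d then a + d else a - d.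
Proof.
rewrite val_iter_ordS; have := ltn_ord a; case: (ltnP a d) => ad an.
  by rewrite modn_small //; lia.
by rewrite -(subnK ad) -addnA addnn -mul2n modnDr addnK modn_small; lia.
Qed.

Lemma antipodeK d : involutive (iter d (@ordS (2 * d))).
Proof.
move=> a; apply: val_inj; have := ltn_ord a.
rewrite !val_antipode; case: (ltnP a d) => ad an.
  by rewrite ltnNge leq_addl /= addnK.
by rewrite ifT ?subnK //; lia.
Qed.

Lemma adj_ordS n (a : C n) : 1 < n -> adj a (ordS a).
Proof.
move=> n1; rewrite /= /C_adj eqxx andbT -val_eqE val_ordS.
by have := ltn_ord a; rewrite /=; case: (a.+1 =P n); lia.
Qed.

Lemma adj_CE n (x y : C n) : adj x y -> y = ordS x \/ x = ordS y.
Proof. by case/andP => _ /orP[]/eqP; [left | right]. Qed.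

(** If two distinct vertices gave the same edge, each would be the successor of the other, forcing
    [n] to be 2. *)
Lemma C_edge_inj n : 2 < n -> injective (@C_edge n).
Proof.
move=> n2 a b ab; move: (set21 a (ordS a)) (set22 a (ordS a)).
rewrite -/(C_edge a) ab => /set2P[//|aSb] /set2P[Sab|/ordS_inj//].
move: (congr1 val aSb) (congr1 val Sab); rewrite !val_ordS /=.
by have := ltn_ord a; case: (a.+1 =P n); case: (b.+1 =P n); lia.
Qed.

Lemma edges_C n : 1 < n -> edges (C n) = [set C_edge a | a : 'I_n].
Proof.
move=> n1; apply/setP => e; apply/imsetP/imsetP => [[[x y]]|[a _ ->]].
  by rewrite inE => /adj_CE[]/= -> ->; [exists x | exists y; rewrite // setUC].
by exists (a, ordS a); rewrite // inE; exact: adj_ordS.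
Qed.

(** * Antipodal classes of edges *)

Section AntipodalClasses.
Variables (d : nat) (d2 : 2 <= d).
Local Notation n := (2 * d).

Let n2 : 2 < n. Proof. by lia. Qed.
Let n1 : 1 < n. Proof. by lia. Qed.

Definition antipodal_class (a : C n) : {set {set C n}} :=
  [set C_edge a; C_edge (iter d (@ordS _) a)].

Lemma mem_antipodal_class a b :
  (C_edge a \in antipodal_class b) = (a == b) || (a == iter d (@ordS _) b).
Proof. by rewrite !inE !(inj_eq (C_edge_inj n2)). Qed.

Lemma eq_antipodal_class a b :
  (antipodal_class a == antipodal_class b) = (C_edge a \in antipodal_class b).
Proof.
apply/eqP/idP => [<-|]; first by rewrite !inE eqxx.
rewrite mem_antipodal_class => /orP[/eqP->//|/eqP->].
by rewrite /antipodal_class antipodeK setUC.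
Qed.

(** A representative in the first half makes [u + d] a valid index, as the formula of [cut] below
    requires. *)
Lemma antipodal_class_half a :
  exists u : C n, u < d /\ antipodal_class a = antipodal_class u.
Proof.
have [ad|da] := ltnP a d; first by exists a.
exists (iter d (@ordS _) a); split.
  by have := val_antipode a; rewrite ltnNge da /= => ->; have := ltn_ord a; lia.
by apply/eqP; rewrite eq_sym eq_antipodal_class mem_antipodal_class eqxx orbT.
Qed.

(** The edges starting at 0, ..., d - 1 represent every class exactly once: the antipode of an index
    below [d] is at least [d]. *)
Lemma card_antipodal : #|antipodal d| = d.
Proof.
have dn : d <= n by lia.
have -> : antipodal d = [set antipodal_class (widen_ord dn i) | i : 'I_d].
  apply/setP => X; apply/imsetP/imsetP => [[a _ ->]|[i _ ->]]; last first.
    by exists (widen_ord dn i).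
  rewrite -/(antipodal_class a); have [u [ud ->]] := antipodal_class_half a.
  by exists (Ordinal ud) => //; congr antipodal_class; apply: val_inj.
rewrite card_imset ?card_ord // => i j /eqP.
rewrite eq_antipodal_class mem_antipodal_class => /orP[]/eqP/(congr1 val).
  by move=> /= ij; apply: val_inj.
by rewrite val_antipode /= ltn_ord; have := ltn_ord i; lia.
Qed.

Lemma partition_antipodal : partition (antipodal d) (edges (C n)).
Proof.
have clE X : X \in antipodal d -> exists a, X = antipodal_class a.
  by case/imsetP => a _ ->; exists a.
apply/and3P; split.
- rewrite edges_C // eqEsubset; apply/andP; split.
    apply/bigcupsP => _ /imsetP[a _ ->]; apply/subsetP => e.
    by rewrite !inE => /orP[]/eqP->; apply: imset_f.
  apply/subsetP => _ /imsetP[a _ ->]; apply/bigcupP.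
  by exists (antipodal_class a); [apply: imset_f | rewrite !inE eqxx].
- apply/trivIsetP => _ _ /clE[a ->] /clE[b ->]; apply: contraR.
  (* Two classes sharing an edge both equal the class of that edge. *)
  case/pred0Pn => e /andP[/= ea eb].
  have {ea} [c [ce ca]] :
      exists c, e = C_edge c /\ C_edge c \in antipodal_class a.
    by move: ea; rewrite !inE => /orP[]/eqP->;
      [exists a | exists (iter d (@ordS _) a)]; rewrite !inE eqxx ?orbT.
  by move: ca eb; rewrite ce -!eq_antipodal_class => /eqP<- /eqP<-.
- by apply/negP => /clE[a /setP/(_ (C_edge a))]; rewrite !inE eqxx.
Qed.

End AntipodalClasses.

(** Lets the edges of a cycle be counted by their starting vertices. If distinct [x] and [y] gave
    the same edge, each would follow the other and the cycle would have length 2. *)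
Lemma next_edge_inj (T : finType) (s : seq T) : uniq s -> 2 < size s ->
  {in s &, injective (fun x => [set x; next s x])}.
Proof.
move=> us s2 x y xs ys exy.
have := set21 x (next s x); rewrite exy => /set2P[//|xny].
have := set22 x (next s x); rewrite exy => /set2P[nxy|]; last first.
  exact: (can_inj (prev_next us)).
(* Rotating [s] to start at [x] exposes the next two vertices [u] and [v]; the successor of [u]
   would be both [v] and [x]. *)
have [i s' es] := rot_to xs.
have nE v : next s v = next (x :: s') v by rewrite -es next_rot.
have us' : uniq (x :: s') by rewrite -es rot_uniq.
have s2' : 2 < size (x :: s') by rewrite -es size_rot.
move: xny; rewrite -nxy !nE {nE nxy}.
case: s' us' s2' {es} => [|u [|v s']] //= + _.
rewrite eqxx !inE !negb_or => /andP[/and3P[xu xv _] _].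
by rewrite eq_sym (negPf xu) eqxx => xv'; rewrite xv' eqxx in xv.
Qed.

(** * Cuts and isometric maps of even cycles *)

Section EvenCycle.
Variables (d : nat) (d2 : 2 <= d).
Local Notation n := (2 * d).
Local Notation antipode := (iter d (@ordS n)).

(** Removing the two edges of the class of [u] leaves two arcs; this is the arc from [u + 1] to
    [u + d], which does not wrap around when [u < d]. *)
Definition cut (u a : C n) : bool := u < a <= u + d.

Lemma cut_adj (u x y : C n) : u < d -> adj x y ->
  cut u x (+) cut u y = ([set x; y] \in antipodal_class u).
Proof.
move=> ud; have step a :
    cut u a (+) cut u (ordS a) = (C_edge a \in antipodal_class u).
  rewrite mem_antipodal_class // -!val_eqE val_antipode ud /cut.
  have := val_ordS a; move: (ordS a) => b /= ->.
  by have := ltn_ord a; case: (a.+1 =P n); lia.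
by case/adj_CE => ->; [exact: step | rewrite addbC setUC; exact: step].
Qed.

(** Both sides of the cut are arcs of [d] consecutive vertices, so rotation by [d] swaps them. *)
Lemma cut_antipode (u a : C n) : u < d -> cut u (antipode a) = ~~ cut u a.
Proof.
move=> ud; rewrite /cut; have := val_antipode a.
move: (antipode a) => b /= ->; have := ltn_ord a.
by case: (ltnP a d); lia.
Qed.

Lemma dist_iter_ordS m (a : C n) : dist a (iter m (@ordS _) a) <= m.
Proof.
elim: m => [|m IH]; first by rewrite distxx.
apply: leq_trans (dist_triangle (iter m (@ordS _) a : C n) _ _) _.
by rewrite -[leqRHS]addn1 leq_add // dist_adj // adj_ordS; lia.
Qed.

(** The two ways round take [m] and [n - m] steps, and one of these is at most [d]. *)
Lemma C_reach (a b : C n) : exists m,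
  m <= d /\ (b = iter m (@ordS _) a \/ a = iter m (@ordS _) b).
Proof.
have reach (u v : C n) : exists2 m, m < n & v = iter m (@ordS _) u.
  have n0 : 0 < n by lia.
  (* This is [v - u] modulo [n], written so that no subtraction is truncated. *)
  exists ((v + (n - u)) %% n); first by rewrite ltn_mod.
  apply/val_inj; rewrite val_iter_ordS /= modnDmr.
  have -> : u + (v + (n - u)) = v + n by have := ltn_ord u; lia.
  by rewrite modnDr modn_small.
have [m mn bE] := reach a b; have [md|dm] := leqP m d.
  by exists m; split; [|left].
exists (n - m); split; first lia; right; apply/val_inj.
rewrite bE !val_iter_ordS /= modnDml.
have -> : a + m + (n - m) = a + n by lia.
by rewrite modnDr modn_small.
Qed.

Lemma diam_C_le : diam (C n) <= d.
Proof.
apply/diam_leP => x y; have [m [md [->|->]]] := C_reach x y;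
  last rewrite dist_sym.
  exact: leq_trans (dist_iter_ordS m x) md.
exact: leq_trans (dist_iter_ordS m y) md.
Qed.

(* A pair at distance m <= d extends to an antipodal pair by a path of length
   d - m, so a contraction keeping antipodal pairs apart cannot shorten it. *)
Lemma antipodal_isometric (H : graph) (f : C n -> H) :
  {homo f : x y / adj x y} ->
  (forall a, d <= dist (f a) (f (antipode a))) -> isometric f.
Proof.
move=> fh fa; have far m (a : C n) : m <= d ->
    dist a (iter m (@ordS _) a) <= dist (f a) (f (iter m (@ordS _) a)).
  move=> md; set b := iter m _ a.
  have bE : antipode a = iter (d - m) (@ordS _) b by rewrite -iterD subnK.
  have := leq_trans (fa a) (dist_triangle (f b) _ _).
  have := leq_trans (dist_homo b (antipode a) fh).
  rewrite bE => /(_ _ (dist_iter_ordS _ _)).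
  by have := dist_iter_ordS m a; rewrite -/b; lia.
move=> x y; apply/eqP; rewrite eqn_leq dist_homo //=.
have [m [md [->|->]]] := C_reach x y; first exact: far.
by rewrite dist_sym [leqRHS]dist_sym; apply: far.
Qed.

(** * Quotient labeling of the antipodal partition *)

Section Quotient.
Variables (t : nat) (F : 'I_t -> {set {set C n}}).
Hypothesis hF : enumerates F (antipodal d).

Lemma enumerates_card : t = d.
Proof.
have [injF eF] := hF.
by rewrite -(card_antipodal d2) -eF card_imset ?card_ord.
Qed.

Lemma enumerates_class j :
  exists u : C n, u < d /\ F j = antipodal_class u.
Proof.
have [_ eF] := hF; have : F j \in antipodal d by rewrite -eF imset_f.
case/imsetP => a _ ->; exact: antipodal_class_half.
Qed.

Lemma edge_class (x y : C n) : adj x y ->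
  exists j, forall j', ([set x; y] \in F j') = (j' == j).
Proof.
have [injF eF] := hF.
have st a : exists j, forall j', (C_edge a \in F j') = (j' == j).
  have: antipodal_class a \in antipodal d by apply: imset_f.
  rewrite -eF => /imsetP[j _ aj]; exists j => j'.
  have [u [_ ju]] := enumerates_class j'.
  by rewrite ju -(eq_antipodal_class d2) aj -ju (inj_eq injF) eq_sym.
by case/adj_CE => ->; [|rewrite setUC]; apply: st.
Qed.

(* Coordinate j is the indicator of one side of the cut formed by class j. *)
Lemma cut_potential : exists psi : C n -> 'rV['F_2]_t,
  (forall x y, adj x y -> psi y - psi x = \row_j ([set x; y] \in F j)%:R)%R /\
  forall a, (psi (antipode a) - psi a)%R = const_mx 1%R.
Proof.
have [u uP] := fin_all_exists enumerates_class.
exists (fun x => \row_j (cut (u j) x)%:R)%R; split=> [x y xy|a];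
  apply/rowP => j;
  rewrite !mxE; have [ud Fj] := uP j.
  by rewrite Fj -cut_adj //; case: cut; case: cut; apply/val_inj.
by rewrite cut_antipode //; case: cut; apply/val_inj.
Qed.

Variable psi : C n -> 'rV['F_2]_t.
Hypothesis psi_adj : forall x y, adj x y ->
  (psi y - psi x = \row_j ([set x; y] \in F j)%:R)%R.
Hypothesis psi_antipode : forall a,
  (psi (antipode a) - psi a)%R = const_mx 1%R.

(** Modulo 2, the class-[j] edges of a cycle count the changes of coordinate [j] of [psi] around it,
    and these sum to zero on a closed walk. *)
Lemma parity_matrix_eq0 c (B : 'I_c -> {set {set C n}}) :
  (forall i, is_cycle (B i)) -> parity_matrix F B = 0%R.
Proof.
move=> cB; apply/matrixP => i j; rewrite !mxE.
have [s [/andP[cs us] s2 ->]] := cB i.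
rewrite -sum1_card natr_sum.
under eq_bigl do rewrite inE andbC.
rewrite big_mkcondr big_imset /=; last exact: next_edge_inj.
rewrite (eq_bigr (fun x => psi (next s x) 0 j - psi x 0 j))%R => [|x xs].
  (* [next] permutes the vertices of the cycle, so the two sums coincide. *)
  rewrite sumrB [X in (_ - X)%R](reindex_inj (can_inj (prev_next us))) /=.
  by under [X in (_ - X)%R]eq_bigl do rewrite mem_next; rewrite subrr.
have := psi_adj (next_cycle cs xs) => /rowP/(_ j); rewrite !mxE => ->.
by case: (_ \in F j).
Qed.

Variables (k : nat) (M : 'M['F_2]_(t, k)).

Lemma edge_labelE x y :
  adj x y -> edge_label F M x y = ((psi y - psi x) *m M)%R.
Proof.
move=> xy; rewrite psi_adj // F2_mulmx_row; apply: eq_bigl => j.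
by rewrite mxE; case: (_ \in F j).
Qed.

(** The edge labels telescope, so the choice of path between two vertices does not matter. *)
Lemma path_labelE x p : path (@adj (C n)) x p ->
  path_label F M x p = ((psi (last x p) - psi x) *m M)%R.
Proof.
elim: p x => [|y p IH] x; first by rewrite /= subrr mul0mx.
rewrite [path _ _ _]/= => /andP[xy yp] /=; rewrite IH // edge_labelE //.
by rewrite -mulmxDl addrC addrA subrK.
Qed.

Hypotheses (freeM : row_free M) (fullM : row_full M).

(** [M] is injective on row vectors, so none of its rows vanishes and no class drops out of the
    generators. *)
Lemma row_quotient_gens j : row j M \in quotient_gens M.
Proof.
apply/imsetP; exists j; rewrite // inE; apply/negP => /eqP Mj0.
have [N MN] := row_freeP freeM.
have /rowP/(_ j)/eqP : row j (1%:M : 'M['F_2]_t) = 0%R.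
  by rewrite -MN row_mul Mj0 mul0mx.
by rewrite !mxE eqxx oner_eq0.
Qed.

Lemma quotient_gens_gen : cay_gen (quotient_gens M).
Proof.
split; first by apply/negP => /imsetP[j]; rewrite inE => /eqP Mj /esym.
apply/setP => v; rewrite in_setT; have [N NM] := row_fullP fullM.
rewrite -[v]mulmx1 -NM mulmxA F2_mulmx_row; apply: gen_rV_sum => j _.
exact: row_quotient_gens.
Qed.

Variables (hS : cay_gen (quotient_gens M)) (r : C n) (l : C n -> Cay hS).
Hypothesis hl : quotient_labeling F M r l.

Lemma quotient_labelingB x y : (l y - l x = (psi y - psi x) *m M)%R.
Proof.
have lE v : l v = ((psi v - psi r) *m M)%R.
  by have [p [pP _ <- ->]] := hl v; rewrite path_labelE.
by rewrite !lE -mulmxBl opprB addrA subrK.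
Qed.

(** An edge lies in exactly one class, so its label is a single row of [M], hence a generator. *)
Lemma quotient_labeling_homo : {homo l : x y / adj x y}.
Proof.
move=> x y xy; rewrite cay_adjD quotient_labelingB -edge_labelE //.
have [j jP] := edge_class xy; rewrite /edge_label (big_pred1 j) //.
exact: row_quotient_gens.
Qed.

(** A right inverse [N] of [M] turns the generators into unit vectors and the displacement between
    antipodal vertices into the all-ones vector, of weight [d]. *)
Lemma quotient_labeling_antipode a : d <= dist (l a) (l (antipode a)).
Proof.
have [N MN] := row_freeP freeM.
rewrite [leqLHS](_ : d = weight ((l (antipode a) - l a) *m N)%R); last first.
  rewrite quotient_labelingB -mulmxA MN mulmx1 psi_antipode weight_const1.
  by rewrite enumerates_card.
apply: weight_le_dist => s /imsetP[j _ ->].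
by rewrite -row_mul MN row1 weight_delta.
Qed.

Lemma quotient_labeling_isometric : isometric l.
Proof.
exact: antipodal_isometric quotient_labeling_homo quotient_labeling_antipode.
Qed.

End Quotient.
End EvenCycle.

(** The bound on antipodal pairs is kept beside the isometry because it also yields the lower bound
    on the diameter of the cycle. *)
Lemma antipodal_quotient d t (F : 'I_t -> {set {set C (2 * d)}}) c
    (B : 'I_c -> {set {set C (2 * d)}}) :
  2 <= d -> enumerates F (antipodal d) -> cycle_basis B ->
  let A := parity_matrix F B in
  [/\ \rank A = 0, t - \rank A = d
    & forall M : 'M['F_2]_(t, t - \rank A), quotient_map M ->
      exists hS : cay_gen (quotient_gens M),
        forall r (l : C (2 * d) -> Cay hS), quotient_labeling F M r l ->
          isometric l /\
          forall a, d <= dist (l a) (l (iter d (@ordS _) a))].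
Proof.
move=> d2 hF [cB _ _] A.
have [psi [psi_adj psi_antipode]] := cut_potential d2 hF.
have A0 : A = 0%R by exact: parity_matrix_eq0 psi_adj _ _ cB.
have rA : \rank A = 0 by rewrite A0 mxrank0.
split=> [//||M [fullM kerM]]; first by rewrite rA subn0 (enumerates_card d2 hF).
(* The kernel of [M] is the row space of [A], which is zero. *)
have freeM : row_free M.
  by rewrite -kermx_eq0 -submx0 kerM -/A A0 sub0mx.
exists (quotient_gens_gen freeM fullM) => r l hl; split.
  exact: (quotient_labeling_isometric d2 hF psi_adj psi_antipode freeM hl).
exact: (quotient_labeling_antipode d2 hF psi_adj psi_antipode freeM hl).
Qed.

(** The dimension obtained is [t - \rank A], equal to [d] only by a proof, so [k] stays a variable
    with the equation [k = d]. *)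
Lemma embeds_C d : 2 <= d ->
  exists k (S : {set 'rV['F_2]_k}) (hS : cay_gen S) (f : C (2 * d) -> Cay hS),
    [/\ k = d, isometric f
      & forall a, d <= dist (f a) (f (iter d (@ordS _) a))].
Proof.
move=> d2; pose F (j : 'I_#|antipodal d|) := enum_val j.
have hF : enumerates F (antipodal d).
  split; first exact: enum_val_inj.
  apply/setP => X; apply/imsetP/idP => [[j _ ->]|Xd]; first exact: enum_valP.
  by exists (enum_rank_in Xd X); rewrite // /F enum_rankK_in.
have [c [B cB]] := cycle_basis_exists (C (2 * d)).
have [_ kd iso] := antipodal_quotient d2 hF cB.
have [M /iso[hS lP]] := quotient_map_exists (parity_matrix F B).
have r : C (2 * d) by apply: (@Ordinal _ 0); lia.
have [l /lP[il al]] := quotient_labeling_exists F M r.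
by exists _, _, hS, l.
Qed.

Lemma diam_C d : 2 <= d -> diam (C (2 * d)) = d.
Proof.
move=> d2; apply/eqP; rewrite eqn_leq diam_C_le //=.
(* Antipodal images are at least [d] apart and the embedding preserves distances, so antipodal
   vertices are too. *)
have [k [S [hS [f [_ iso far]]]]] := embeds_C d2.
have r : C (2 * d) by apply: (@Ordinal _ 0); lia.
by apply: leq_trans (far r) _; rewrite iso dist_le_diam.
Qed.

Lemma kmin_C d : 2 <= d -> is_kmin (C (2 * d)) d.
Proof.
move=> d2; split=> [|k /embeds_diam]; last by rewrite diam_C.
have [k [S [hS [f [kd iso _]]]]] := embeds_C d2.
by move: S hS f iso; rewrite kd => S hS f iso; exists S, hS, f.
Qed.

Theorem proposition2p36 (R : realType) :
  [/\ forall t : nat,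
        [/\ is_kmin (Q t) t, diam (Q t) = t
          & log2 (#|Q t|%:R : R)%R = (t%:R)%R],
      forall t : nat, 1 <= t ->
        [/\ is_kmin (K (2 ^ t)) t, diam (K (2 ^ t)) = 1
          & exists f : K (2 ^ t) -> Cay (nonzero_gen t),
              graph_iso f /\ isometric f]
    & forall d : nat, 2 <= d ->
        [/\ is_kmin (C (2 * d)) d, diam (C (2 * d)) = d,
            partition (antipodal d) (edges (C (2 * d)))
          & forall (t : nat) (F : 'I_t -> {set {set C (2 * d)}}),
              enumerates F (antipodal d) ->
              t = d /\
              forall (c : nat) (B : 'I_c -> {set {set C (2 * d)}}),
                cycle_basis B ->
                let A := parity_matrix F B in
                [/\ \rank A = 0, t - \rank A = d
                  & forall M : 'M['F_2]_(t, t - \rank A),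
                      quotient_map M ->
                      exists hS : cay_gen (quotient_gens M),
                        forall (r : C (2 * d))
                               (l : C (2 * d) -> 'rV['F_2]_(t - \rank A)),
                          quotient_labeling F M r l ->
                          isometric (l : C (2 * d) -> Cay hS)]]].
Proof.
split=> [t|t t1|d d2].
- split; [exact: kmin_Q | exact: diam_Q | by rewrite card_rV_F2 log2_exp].
- split; [exact: kmin_K | | exact: K_iso_Cay].
  by rewrite diam_K // -(expn0 2) ltn_exp2l.
- split; [exact: kmin_C | exact: diam_C | exact: partition_antipodal |].
  move=> t F hF; split; first exact: enumerates_card hF.
  move=> c B cB; have [rA kd iso] := antipodal_quotient d2 hF cB.
  split=> // M /iso[hS lP]; exists hS => r l /lP[il _]; exact: il.
Qed.
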